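(* In the quantum number-in-hand network model, for every integer $d\ge1$ there is a quantum protocol with communication cost $O(kd\log^2 k)$ qubits which, with probability at least $2/3$, outputs the list of all max-$d$-isolated cliques of the input $k$-node graph.
   Context: Quantum number-in-hand (NIH) network model: the input is an undirected graph $G=(V,E)$ without self-loops on $V=[k]$; player $v$ receives only $\nu_v\in\{0,1\}^k$, the characteristic vector of its neighborhood; each player sends one quantum message depending only on its own input (no shared randomness or entanglement) to a referee who produces the output; cost is the total number of qubits sent. A set $S\subseteq V$ is a max-$d$-isolated clique if the induced subgraph $G[S]$ is a clique and each node of $S$ has at most $d$ neighbors in $V\setminus S$. *)

(* Defs.v *)
From HB Require Import structures.
From mathcomp Require Import all_boot all_order all_algebra.
From mathcomp Require Import complex.
From mathcomp Require Import reals Rstruct.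
Set Implicit Arguments. Unset Strict Implicit. Unset Printing Implicit Defensive.
Import Order.TTheory GRing.Theory Num.Theory.
Local Open Scope ring_scope.

(* Complex numbers: C = R[i] with R the (Stdlib) real numbers, a realType
   (hence real closed), so R[i] is a numClosedFieldType. *)
Definition C : numClosedFieldType := (Rdefinitions.R)[i].

(* Operators on a finite-dimensional Hilbert space with orthonormal basis
   indexed by a finite type T, given by their matrix entries. *)
Definition op (T : finType) := T -> T -> C.

Definition psd (T : finType) (M : op T) : Prop :=
  exists A : op T, forall x y, M x y = \sum_z A x z * (A y z)^*.

Definition trace (T : finType) (M : op T) : C := \sum_x M x x.

Definition density (T : finType) (rho : op T) : Prop :=
  psd rho /\ trace rho = 1.

Definition povm (T O : finType) (E : O -> op T) : Prop :=
  (forall o, psd (E o)) /\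
  (forall x y, \sum_o E o x y = (x == y)%:R).

(* The register of n qubits has basis {0,1}^n, indexed by 'I_(2^n). *)
Definition qreg (n : nat) := 'I_(2 ^ n).

Definition simple_graph (k : nat) (g : rel 'I_k) : Prop :=
  symmetric g /\ irreflexive g.

Definition nbhd_vec (k : nat) (g : rel 'I_k) (v : 'I_k) : {ffun 'I_k -> bool} :=
  [ffun u => g v u].

Definition is_clique (k : nat) (g : rel 'I_k) (S : {set 'I_k}) : bool :=
  [forall u in S, forall w in S, (u != w) ==> g u w].

Definition max_d_isolated_clique (k d : nat) (g : rel 'I_k) (S : {set 'I_k}) : bool :=
  is_clique g S && [forall u in S, (#|[set w in ~: S | g u w]| <= d)%N].

Definition all_max_d_isolated_cliques (k d : nat) (g : rel 'I_k) : {set {set 'I_k}} :=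
  [set S | max_d_isolated_clique d g S].

(* Quantum number-in-hand protocol for k players with outcome type O.
   Player v sends nq v qubits in the (possibly mixed) state msg v (nu_v),
   which depends only on v and its own input nu_v; there is no shared
   randomness or entanglement, so the joint state is the tensor product.
   The referee measures the joint register with a POVM. *)
Record qnih_protocol (k : nat) (O : finType) := QNIH {
  nq : 'I_k -> nat;
  msg : forall v : 'I_k, {ffun 'I_k -> bool} -> op (qreg (nq v));
  referee : O -> op {dffun forall v : 'I_k, qreg (nq v)}
}.

Definition valid_protocol (k : nat) (O : finType) (P : qnih_protocol k O) : Prop :=
  (forall v x, density (@msg k O P v x)) /\ povm (@referee k O P).

Definition cost (k : nat) (O : finType) (P : qnih_protocol k O) : nat :=
  \sum_(v < k) nq P v.

Definition joint_state (k : nat) (O : finType) (P : qnih_protocol k O)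
    (g : rel 'I_k) : op {dffun forall v : 'I_k, qreg (nq P v)} :=
  fun x y => \prod_(v < k) @msg k O P v (nbhd_vec g v) (x v) (y v).

Definition out_prob (k : nat) (O : finType) (P : qnih_protocol k O)
    (g : rel 'I_k) (o : O) : C :=
  trace (fun x y => \sum_z @referee k O P o x z * @joint_state k O P g z y).

Arguments joint_state {k O} P g.
Arguments out_prob {k O} P g o.
Arguments valid_protocol {k O} P.
Arguments cost {k O} P.

(* Main.v *)
Require Import Defs.
From HB Require Import structures.
From mathcomp Require Import all_boot all_order all_algebra.
From mathcomp Require Import finfield complex reals Rstruct ring lra.
Import Order.TTheory GRing.Theory Num.Theory.
Local Open Scope ring_scope.
Set Implicit Arguments. Unset Strict Implicit. Unset Printing Implicit Defensive.

(* Player [v] sends a real unit vector [f nu_v] of [O(d log k)] qubits, where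
   distinct inputs have inner product at most [q^-11] with [q = 2^(d log k)].
   For [v \in S] only [q^2] inputs are compatible with [S] being a
   max-d-isolated clique (choose the at most [d] neighbours outside [S]); let
   [Pi_(v,S)] project onto the span of their fingerprints.  It fixes a compatible
   fingerprint, and maps an incompatible one to a vector of norm at most [q^-8].
   The referee measures, for all sets [S] one after the other, the projector
   [P_S = \bigotimes_(v in S) Pi_(v,S)] and outputs the accepted [S].  A true
   clique is accepted with certainty and without disturbing the state.  A set
   with [b] incompatible members changes the state by at most [q^(-8b)], and the
   sum of these errors over all sets with [b > 0] is at most [1/8]: there are at
   most [k q^2] sets with a compatible member, and the remaining ones have
   [b = #|S|]. *)

(** * Real inner products and orthogonal projectors *)

Section RealVectors.
Variable F : realFieldType.

Definition dot n (u v : 'cV[F]_n) : F := (u^T *m v) 0 0.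

Lemma dotE n (u v : 'cV[F]_n) : dot u v = \sum_i u i 0 * v i 0.
Proof. by rewrite /dot mxE; apply: eq_bigr => i _; rewrite mxE. Qed.

Lemma dotC n (u v : 'cV[F]_n) : dot u v = dot v u.
Proof. by rewrite !dotE; apply: eq_bigr => i _; rewrite mulrC. Qed.

Lemma dotDr n (u v w : 'cV[F]_n) : dot u (v + w) = dot u v + dot u w.
Proof. by rewrite /dot mulmxDr mxE. Qed.

Lemma dotBr n (u v w : 'cV[F]_n) : dot u (v - w) = dot u v - dot u w.
Proof. by rewrite /dot mulmxBr !mxE. Qed.

Lemma dotZr n a (u v : 'cV[F]_n) : dot u (a *: v) = a * dot u v.
Proof. by rewrite /dot -scalemxAr mxE. Qed.

Lemma dotBl n (u v w : 'cV[F]_n) : dot (u - v) w = dot u w - dot v w.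
Proof. by rewrite !(dotC _ w) dotBr. Qed.

Lemma dotZl n a (u v : 'cV[F]_n) : dot (a *: u) v = a * dot u v.
Proof. by rewrite !(dotC _ v) dotZr. Qed.

Lemma dot_mulmxl m n (A : 'M[F]_(m, n)) u v : dot (A *m u) v = dot u (A^T *m v).
Proof. by rewrite /dot trmx_mul mulmxA. Qed.

Lemma dot_ge0 n (u : 'cV[F]_n) : 0 <= dot u u.
Proof. by rewrite dotE sumr_ge0 // => i _; rewrite -expr2 sqr_ge0. Qed.

Lemma dot_eq0 n (u : 'cV[F]_n) : dot u u = 0 -> u = 0.
Proof.
rewrite dotE => /eqP; rewrite psumr_eq0 => [/allP h|i _]; last first.
  by rewrite -expr2 sqr_ge0.
apply/colP => i; rewrite mxE; apply/eqP.
by have := h i (mem_index_enum _); rewrite /= -expr2 sqrf_eq0.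
Qed.

Lemma dot_sqr_le n (u v : 'cV[F]_n) : dot u v ^+ 2 <= dot u u * dot v v.
Proof.
have [v0|v_neq0] := eqVneq (dot v v) 0.
  by rewrite (dot_eq0 v0) /dot !mulmx0 mxE expr0n mulr0.
have v_gt0 : 0 < dot v v by rewrite lt_def v_neq0 dot_ge0.
have := dot_ge0 (dot v v *: u - dot u v *: v).
rewrite !(dotBl, dotBr, dotZl, dotZr) (dotC v u) => h.
rewrite -subr_ge0 -(pmulr_rge0 _ v_gt0); apply: le_trans h _.
by rewrite le_eqVlt; apply/orP; left; apply/eqP; ring.
Qed.

Definition orthoproj n (P : 'M[F]_n) := (P^T == P) && (P *m P == P).

Lemma proj_dot n (P : 'M[F]_n) u : orthoproj P -> dot (P *m u) (P *m u) = dot u (P *m u).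
Proof.
by case/andP=> /eqP PT /eqP PP; rewrite dot_mulmxl PT mulmxA PP.
Qed.

(** One Gram-Schmidt step: [w] is orthogonal to the range of [P], so the cross terms vanish when the
    rank-one projector onto [w] is added. *)
Lemma orthoproj_add n (P : 'M[F]_n) v (w := v - P *m v) :
  orthoproj P -> dot w w != 0 -> orthoproj (P + (dot w w)^-1 *: (w *m w^T)).
Proof.
case/andP=> /eqP PT /eqP PP w0.
have Pw : P *m w = 0 by rewrite mulmxBr mulmxA PP subrr.
have wP : w^T *m P = 0 by rewrite -[w^T *m P]trmxK trmx_mul trmxK PT Pw trmx0.
have ww : w^T *m w = (dot w w)%:M by rewrite [LHS]mx11_scalar.
rewrite /orthoproj linearD linearZ /= trmx_mul trmxK PT eqxx /=; apply/eqP.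
rewrite mulmxDl !mulmxDr PP -!scalemxAl -!scalemxAr -!mulmxA wP mulmx0.
rewrite (mulmxA P) Pw mul0mx !scaler0 addr0 add0r (mulmxA w^T) ww.
by rewrite mul_scalar_mx -scalemxAr !scalerA mulrA divfK.
Qed.

(* Gram-Schmidt one vector at a time: the component [w] of a new vector
   orthogonal to the previous ones satisfies [|w|^2 >= 1/2] and
   [|<w, x>| <= 2 e], so each step adds at most [(2 e)^2 / (1/2) = 8 e^2]. *)
Lemma near_orthonormal_projector n (s : seq 'cV[F]_n) (e : F) :
  0 <= e -> 8 * (size s)%:R * e <= 1 ->
  all (fun v => dot v v == 1) s ->
  pairwise (fun u v => `|dot u v| <= e) s ->
  exists P : 'M[F]_n, [/\ orthoproj P, {in s, forall v, P *m v = v} &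
    forall x, dot x x = 1 -> {in s, forall v, `|dot v x| <= e} ->
      dot x (P *m x) <= 8 * (size s)%:R * e ^+ 2].
Proof.
move=> e0; elim: s => [|v s IH] /=.
  move=> _ _ _; exists 0; split=> // [|x _ _]; last first.
    by rewrite mul0mx /dot mulmx0 mxE mulr0 mul0r.
  by rewrite /orthoproj trmx0 mulmx0 eqxx.
rewrite -[(size s).+1%:R]natr1 => small /andP[/eqP v1 s1] /andP[vs ss].
have s0 : 0 <= (size s)%:R :> F by rewrite ler0n.
have se0 : 0 <= (size s)%:R * e by apply: mulr_ge0.
have [] := IH _ s1 ss; first by move: small se0; lra.
move=> P [Pproj Ps Pbound].
have [/eqP PT /eqP PP] := andP Pproj.
set b := 8 * (size s)%:R * e ^+ 2 in Pbound.
have b_le : b <= e.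
  by rewrite /b expr2 mulrA ler_piMl //; move: small e0; lra.
have vPv : dot v (P *m v) <= b.
  by apply: Pbound => // u us; rewrite dotC; move/allP: vs; apply.
pose w := v - P *m v.
have wE x : dot w x = dot v x - dot (P *m v) (P *m x).
  by rewrite dotBl [in RHS]dot_mulmxl PT mulmxA PP dot_mulmxl PT.
have wv : dot w v = dot w w.
  rewrite [RHS]dotBr [X in _ = _ - X]wE mulmxA PP proj_dot //.
  by rewrite subrr subr0.
have ww : dot w w = 1 - dot v (P *m v) by rewrite -wv wE v1 proj_dot.
(* By [small], [e] is at most [1/8], and [v] loses at most [b <= e] of its squared norm. *)
have ww_ge : 2^-1 <= dot w w.
  by rewrite ww; move: small se0 b_le vPv e0; lra.
have ww0 : dot w w != 0 by apply: lt0r_neq0; move: ww_ge; lra.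
exists (P + (dot w w)^-1 *: (w *m w^T)).
have P'x x : (P + (dot w w)^-1 *: (w *m w^T)) *m x =
    P *m x + ((dot w w)^-1 * dot w x) *: w.
  rewrite mulmxDl -scalemxAl -mulmxA [w^T *m x]mx11_scalar mul_mx_scalar.
  by rewrite scalerA.
split; first exact: orthoproj_add.
  move=> u; rewrite inE P'x => /orP[/eqP->|us].
    by rewrite wv mulVf // scale1r addrC subrK.
  have -> : dot w u = 0.
    by rewrite wE dot_mulmxl PT (Ps _ us) (Ps _ us) subrr.
  by rewrite mulr0 scale0r addr0 Ps.
move=> x x1 xs; rewrite P'x dotDr dotZr (dotC x w).
have xPx : dot x (P *m x) <= b.
  by apply: Pbound => // u us; apply: xs; rewrite inE us orbT.
have vx : `|dot v x| <= e by apply: xs; rewrite inE eqxx.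
(* By Cauchy-Schwarz the square is at most [b * b], since [P] leaves squared norm at most [b] of
   both [v] and [x]. *)
have PvPx : `|dot (P *m v) (P *m x)| <= e.
  apply: le_trans b_le; have b0 : 0 <= b.
    by rewrite mulr_ge0 ?sqr_ge0 ?mulr_ge0.
  rewrite -(ler_pXn2r (ltn0Sn 1)) ?nnegrE // real_normK ?num_real //.
  apply: le_trans (dot_sqr_le _ _) _; rewrite !proj_dot // expr2.
  by apply: ler_pM => //; rewrite -proj_dot // dot_ge0.
have wx : `|dot w x| <= 2 * e.
  rewrite wE; apply: le_trans (ler_normB _ _) _.
  by move: vx PvPx; lra.
rewrite mulrDr mulrDl -/b lerD // mulr1.
have wx2 : dot w x * dot w x <= 4 * e ^+ 2.
  rewrite -expr2 -real_normK ?num_real //.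
  have -> : 4 * e ^+ 2 = (2 * e) ^+ 2 by ring.
  by rewrite ler_pXn2r ?nnegrE ?mulr_ge0.
rewrite -mulrA ler_pdivrMl ?(lt_le_trans _ ww_ge) ?invr_gt0 //.
apply: le_trans wx2 _; have := sqr_ge0 e => e20.
have -> : 4 * e ^+ 2 = 2^-1 * (8 * e ^+ 2) by field.
by rewrite ler_wpM2r // mulr_ge0.
Qed.

(* Measure [{P i, 1 - P i}] for each [i] of [s] in turn, the head first; the
   outcome [o] records the accepting tests. *)
Fixpoint seq_meas n (I : finType) (P : I -> 'M[F]_n) (s : seq I) (o : {set I}) :
    'M[F]_n :=
  if s is i :: s' then
    seq_meas P s' o *m (if i \in o then P i else 1%:M - P i)
  else 1%:M.

Lemma orthoprojC n (P : 'M[F]_n) : orthoproj P -> orthoproj (1%:M - P).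
Proof.
case/andP=> /eqP PT /eqP PP; rewrite /orthoproj linearB /= trmx1 PT eqxx.
by rewrite mulmxBr mulmx1 mulmxBl mul1mx PP subrr subr0 eqxx.
Qed.

(** * Completeness and disturbance of sequential measurements *)

Section SequentialMeasurement.
Variables (n : nat) (I : finType) (P : I -> 'M[F]_n).
Hypothesis Pproj : forall i, orthoproj (P i).

Lemma seq_meas_setU1 s i o :
  i \notin s -> seq_meas P s (i |: o) = seq_meas P s o.
Proof.
elim: s => //= j s IH; rewrite inE negb_or => /andP[ij js].
by rewrite IH // !inE eq_sym (negPf ij).
Qed.

(* The sum is restricted to [o \subset s] because [seq_meas P s o] ignores the
   part of [o] outside [s]. *)
Lemma seq_meas_complete s : uniq s ->
  \sum_(o : {set I} | o \subset s) (seq_meas P s o)^T *m seq_meas P s o = 1%:M.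
Proof.
elim: s => [|i s IH] /=.
  move=> _; rewrite (big_pred1 set0) ?trmx1 ?mulmx1 // => o.
  apply/idP/eqP => [/subsetP h|->]; last by apply/subsetP => j; rewrite inE.
  by apply/setP => j; rewrite inE; apply/negP => /h.
(* Outcomes containing [i] are [i |: o] with [o] inside the tail, the others are such [o]
   themselves. By induction the two halves sum to [P i] and [1 - P i]. *)
case/andP=> is_ us; rewrite (bigID (fun o : {set I} => i \in o)) /=.
have [/eqP PT /eqP PP] := andP (Pproj i).
have [/eqP QT /eqP QQ] := andP (orthoprojC (Pproj i)).
rewrite (reindex_onto (fun o => i |: o) (fun o => o :\ i)) /=; last first.
  by move=> o /andP[_ io]; rewrite setD1K.
rewrite (eq_bigl (fun o : {set I} => o \subset s)); last first.
  move=> o; rewrite setU11 andbT; apply/andP/idP.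
    case=> /subsetP h /eqP e; apply/subsetP => j jo.
    have := h j; rewrite !inE jo orbT => /(_ isT) /orP[/eqP ji|//].
    by move: jo; rewrite -e ji !inE eqxx.
  move=> /subsetP h; split; first apply/subsetP => j.
    by rewrite !inE => /orP[->//|/h ->]; rewrite orbT.
  rewrite setU1K //; apply/negP => /h; exact/negP.
rewrite (eq_bigr (fun o => P i *m ((seq_meas P s o)^T *m seq_meas P s o) *m P i));
  last first.
  by move=> o _; rewrite setU11 seq_meas_setU1 // trmx_mul PT !mulmxA.
rewrite -mulmx_suml -mulmx_sumr IH // mulmx1 PP.
rewrite (eq_bigl (fun o : {set I} => o \subset s)); last first.
  move=> o; apply/andP/idP.
    case=> /subsetP h io; apply/subsetP => j jo; have := h j jo.
    by rewrite inE => /orP[/eqP ji|//]; rewrite -ji jo in io.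
  move=> /subsetP h; split; last by apply/negP => /h; apply/negP.
  by apply/subsetP => j /h js; rewrite inE js orbT.
rewrite (eq_bigr (fun o => (1%:M - P i) *m
    ((seq_meas P s o)^T *m seq_meas P s o) *m (1%:M - P i))); last first.
  move=> o /subsetP h; have /negPf-> : i \notin o by apply/negP => /h; apply/negP.
  by rewrite trmx_mul QT !mulmxA.
by rewrite -mulmx_suml -mulmx_sumr IH // mulmx1 QQ addrC subrK.
Qed.

Lemma proj_contract (Q : 'M[F]_n) u : orthoproj Q -> dot (Q *m u) (Q *m u) <= dot u u.
Proof.
move=> Qp; rewrite proj_dot // -subr_ge0 -dotBr -{2}[u]mul1mx -mulmxBl.
by rewrite -proj_dot ?orthoprojC ?dot_ge0.
Qed.

Lemma seq_meas_contract s o u :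
  dot (seq_meas P s o *m u) (seq_meas P s o *m u) <= dot u u.
Proof.
elim: s u => [|i s IH] u /=; first by rewrite mul1mx.
rewrite -mulmxA; apply: le_trans (IH _) (proj_contract _ _).
by case: ifP => // _; apply: orthoprojC.
Qed.

(** A test in [o] fixes [u]. A test outside [o] replaces [u] by [u - P i u]; the later tests
    contract norms, so by Cauchy-Schwarz the subtracted part costs at most [|P i u| <= e i] of
    amplitude. *)
Lemma seq_meas_amplitude s (o : {set I}) (e : I -> F) u : dot u u = 1 ->
  (forall i, 0 <= e i) -> {in o, forall i, P i *m u = u} ->
  (forall i, i \notin o -> dot u (P i *m u) <= e i ^+ 2) ->
  1 - \sum_(i <- s | i \notin o) e i <= dot u (seq_meas P s o *m u).
Proof.
move=> u1 e0 uo ue; elim: s => [|i s IH] /=.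
  by rewrite big_nil subr0 mul1mx u1.
rewrite big_cons -mulmxA; case: (boolP (i \in o)) => io /=.
  by rewrite uo.
rewrite mulmxBl mul1mx mulmxBr dotBr.
suff : dot u (seq_meas P s o *m (P i *m u)) <= e i by move: IH; lra.
apply: le_trans (ler_norm _) _.
rewrite -(ler_pXn2r (ltn0Sn 1)) ?nnegrE // real_normK ?num_real //.
apply: le_trans (dot_sqr_le _ _) _; rewrite u1 mul1r.
apply: le_trans (seq_meas_contract _ _ _) _.
by rewrite proj_dot // ue.
Qed.

End SequentialMeasurement.
End RealVectors.

(** * Reed-Solomon fingerprints *)

Lemma card_poly_agree (K : finFieldType) k (x y : 'rV[K]_k) : x != y ->
  (#|[set i : K | (rVpoly x).[i] == (rVpoly y).[i]]| <= k)%N.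
Proof.
move=> xy; have p0 : rVpoly x - rVpoly y != 0.
  by rewrite subr_eq0 (can_eq (@rVpolyK _ _)).
rewrite cardE; apply: ltnW; apply: leq_trans (max_poly_roots p0 _ (enum_uniq _)) _.
  by apply/allP => i; rewrite mem_enum inE /root !hornerE subr_eq0.
apply: leq_trans (size_polyD _ _) _.
by rewrite size_polyN geq_max !size_poly.
Qed.

(* Reed-Solomon fingerprints: [x] is the coefficient vector of a polynomial over
   the field with [4 ^ h] elements, and [f x] is the uniform superposition of the
   points of its graph. *)
Lemma fingerprints (F : realFieldType) k h : (0 < h)%N ->
  exists f : {ffun 'I_k -> bool} -> 'cV[F]_(2 ^ (4 * h)),
    (forall x, dot (f x) (f x) = 1) /\
    (forall x y, x != y -> `|dot (f x) (f y)| <= k%:R / 4 ^+ h).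
Proof.
(* The field size is an even power of 2, so the normalisation [1 / 2 ^ h] needs no square root in
   [F]; a point of the plane takes [4 * h] qubits. *)
move=> h0; have h2 : (0 < 2 * h)%N by rewrite muln_gt0.
have [K _ cardK] := pPrimePowerField (isT : prime 2) h2.
have cKK : (2 ^ (4 * h))%N = #|{: K * K}|.
  by rewrite card_prod cardK -expnD -mulnDl.
pose row (x : {ffun 'I_k -> bool}) : 'rV[K]_k := \row_i (x i)%:R.
have row_inj : injective row.
  move=> x y /rowP e; apply/ffunP => i; have := e i; rewrite !mxE.
  case: (x i) (y i) => [] [] //= /eqP; first by rewrite oner_eq0.
  by rewrite eq_sym oner_eq0.
pose ev x (i : K) := (rVpoly (row x)).[i].
pose f x := \col_j (let u := enum_val (cast_ord cKK j) in
  (ev x u.1 == u.2)%:R / 2 ^+ h) : 'cV[F]_(2 ^ (4 * h)).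
have dotf x y : dot (f x) (f y) = #|[set i | ev x i == ev y i]|%:R / 4 ^+ h.
  pose G (u : K * K) : F :=
    (ev x u.1 == u.2)%:R * (ev y u.1 == u.2)%:R / 4 ^+ h.
  rewrite dotE.
  rewrite (eq_bigr (fun j => G (enum_val (cast_ord cKK j)))); last first.
    move=> j _; rewrite !mxE /G /=.
    have -> : (4 : F) = 2 * 2 by rewrite -natrM.
    by rewrite exprMn invfM; ring.
  rewrite -(reindex (fun j => enum_val (cast_ord cKK j)) (P := predT)) /=; last first.
    apply: onW_bij; exists (fun u => cast_ord (esym cKK) (enum_rank u)) => u.
      by rewrite enum_valK cast_ordK.
    by rewrite cast_ordKV enum_rankK.
  rewrite -(pair_bigA _ (fun i j => G (i, j))) /= -sum1dep_card natr_sum mulr_suml.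
  rewrite [RHS]big_mkcond; apply: eq_bigr => i _; rewrite /G /=.
  (* On each vertical line only the point of the graph of [x] can contribute, and it does when the
     two polynomials agree at [i]. *)
  rewrite (bigD1 (ev x i)) //= eqxx big1 => [|j ji]; last first.
    by rewrite eq_sym (negPf ji) !mul0r.
  by rewrite addr0 mul1r (eq_sym (ev y i)); case: eqP => _; rewrite ?mul0r.
exists f; split=> [x|x y xy].
  rewrite dotf (_ : [set _ | _] = setT) ?cardsT ?cardK; last first.
    by apply/setP => i; rewrite !inE eqxx.
  by rewrite natrX exprM -natrX divff // expf_neq0 // pnatr_eq0.
have h4 : 0 < (4 : F) ^+ h by rewrite exprn_gt0 // ltr0n.
rewrite dotf ger0_norm ?mulr_ge0 ?ler0n ?invr_ge0 ?(ltW h4) //.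
rewrite ler_wpM2r ?invr_ge0 ?(ltW h4) // ler_nat card_poly_agree //.
by rewrite (inj_eq row_inj).
Qed.

(** * Elementary estimates *)

Lemma expr1D_sub1_le (F : realFieldType) (e : F) n :
  0 <= e -> 2 * n%:R * e <= 1 -> (1 + e) ^+ n - 1 <= 2 * n%:R * e.
Proof.
move=> e0; elim: n => [|n IH]; first by rewrite expr0 subrr mulr0 mul0r.
rewrite -[n.+1%:R]natr1 => h; rewrite exprS.
have ne0 : 0 <= n%:R * e by rewrite mulr_ge0.
have {}IH : (1 + e) ^+ n <= 1 + 2 * n%:R * e.
  by rewrite -lerBlDl; apply: IH; move: h; lra.
have e1 : 0 <= 1 + e by rewrite addr_ge0.
rewrite lerBlDl; apply: le_trans (ler_wpM2l e1 IH) _.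
have : e * (2 * n%:R * e) <= e * 1 by rewrite ler_wpM2l //; move: h; lra.
by lra.
Qed.

(** A set of at most [d] elements is the set of proper values of a map from ['I_d] to [option T],
    with [None] filling the spare positions. *)
Lemma card_small_sets (T : finType) d :
  (#|[set D : {set T} | (#|D| <= d)%N]| <= #|T|.+1 ^ d)%N.
Proof.
pose im (f : {ffun 'I_d -> option T}) := [set w | [exists i, f i == Some w]].
rewrite -[X in (_ <= _ ^ X)%N]card_ord -card_option -card_ffun -cardsT.
apply: leq_trans (leq_imset_card im _); apply/subset_leq_card/subsetP => D.
rewrite inE => Dd; apply/imsetP.
exists [ffun i : 'I_d => nth None (map Some (enum D)) i]; rewrite ?inE //.
apply/setP => w; rewrite inE; apply/idP/existsP => [wD|[j]].
  have iD : (index w (enum D) < size (enum D))%N by rewrite index_mem mem_enum.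
  have id_ : (index w (enum D) < d)%N by apply: leq_trans Dd; rewrite cardE.
  by exists (Ordinal id_); rewrite ffunE /= (nth_map w) // nth_index // mem_enum //.
rewrite ffunE; case: (ltnP j (size (enum D))) => jD.
  by rewrite (nth_map w) // => /eqP[<-]; rewrite -mem_enum mem_nth.
by rewrite nth_default ?size_map.
Qed.

(** * Compatible inputs and the total error over all sets *)

Section Accepted.
Variables (V : finType) (d : nat).

(* [x] is the neighbourhood vector of [v]; [x v] is required to be false because
   the graph has no loops, which makes [x] determined by [S] and [x] outside [S]. *)
Definition accepted (v : V) (S : {set V}) (x : {ffun V -> bool}) :=
  [&& ~~ x v, [forall w in S, (w != v) ==> x w] & (#|[set w in ~: S | x w]| <= d)%N].

Lemma card_accepted_inputs v (S : {set V}) : v \in S ->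
  (#|[set x | accepted v S x]| <= #|V|.+1 ^ d)%N.
Proof.
move=> vS; apply: leq_trans (card_small_sets V d).
pose D (x : {ffun V -> bool}) := [set w in ~: S | x w].
rewrite -(card_in_imset (f := D)).
  apply/subset_leq_card/subsetP => E /imsetP[x]; rewrite !inE => /and3P[_ _ xd].
  by move=> ->.
move=> x y; rewrite !inE => /and3P[xv /forall_inP xS _] /and3P[yv /forall_inP yS _].
move=> /setP DD; apply/ffunP => w; case: (boolP (w \in S)) => wS.
  case: (eqVneq w v) => [->|wv]; first by rewrite (negPf xv) (negPf yv).
  by have := xS w wS; have := yS w wS; rewrite wv /= => -> ->.
by have := DD w; rewrite !inE wS.
Qed.

(** Given [v] and [x], the set [S] is recovered from its few outside neighbours [D S]: remove them
    from the closed neighbourhood of [v]. *)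
Lemma card_accepted_sets v x :
  (#|[set S : {set V} | (v \in S) && accepted v S x]| <= #|V|.+1 ^ d)%N.
Proof.
apply: leq_trans (card_small_sets V d).
pose D (S : {set V}) := [set w in ~: S | x w].
rewrite -(card_in_imset (f := D)).
  apply/subset_leq_card/subsetP => E /imsetP[S]; rewrite !inE => /and4P[_ _ _ xd].
  by move=> ->.
suff rec (S : {set V}) : (v \in S) && accepted v S x -> S = (v |: [set w | x w]) :\: D S.
  by move=> S S'; rewrite !inE => /rec{2}-> /rec{2}-> ->.
case/and4P=> vS xv /forall_inP xS _; apply/setP => w; rewrite !inE.
case: (boolP (w \in S)) => wS /=.
  by case: eqVneq => //= wv; have := xS w wS; rewrite wv.
case: eqVneq => [wv|_] /=; first by rewrite -wv (negPf wS) in vS.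
by case: (x w).
Qed.

Definition rejecting (x : V -> {ffun V -> bool}) (S : {set V}) :=
  [set u in S | ~~ accepted u S (x u)].

Variable F : realFieldType.

(* A vertex accepts few sets, so few sets have an accepting member; in all the
   other sets every member rejects, and these contribute at most
   [\sum_(S != set0) e ^+ #|S| = (1 + e) ^+ #|V| - 1]. *)
Lemma sum_rejecting (x : V -> {ffun V -> bool}) (e : F) :
  0 <= e -> e <= 1 ->
  \sum_(S : {set V} | rejecting x S != set0) e ^+ #|rejecting x S| <=
    (#|V| * #|V|.+1 ^ d)%:R * e + ((1 + e) ^+ #|V| - 1).
Proof.
move=> e0 e1.
rewrite (bigID (fun S : {set V} => [exists u, (u \in S) && accepted u S (x u)])) /=.
apply: lerD.
  (* Union bound: a set with a rejecting member costs at most [e], which is charged to its accepting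
     members. *)
  pose c (S : {set V}) u := if (u \in S) && accepted u S (x u) then e else 0.
  have c0 S u : 0 <= c S u by rewrite /c; case: ifP.
  apply: (@le_trans _ _ (\sum_(S : {set V}) \sum_u c S u)).
    rewrite big_mkcond; apply: ler_sum => S _.
    case: ifP => [/andP[S0 /existsP[u uS]]|_]; last by apply: sumr_ge0.
    rewrite (bigD1 u) //= {1}/c uS -[leLHS]addr0 lerD ?sumr_ge0 //.
    by rewrite -[leRHS]expr1; apply: ler_wiXn2l; rewrite // card_gt0.
  rewrite exchange_big -sum_nat_const natr_sum mulr_suml; apply: ler_sum => u _.
  rewrite -big_mkcond sumr_const -[leLHS]mulr_natl ler_wpM2r // ler_nat.
  by rewrite -cardsE card_accepted_sets.
(* Expanding the product of [#|V|] factors [e + 1] yields one term [e ^+ #|S|] per subset [S]; the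
   empty set gives the 1. *)
have -> : (1 + e) ^+ #|V| - 1 = \sum_(S : {set V} | S != set0) e ^+ #|S|.
  have <- : \prod_(i : V) (e + 1) = (1 + e) ^+ #|V| by rewrite prodr_const addrC.
  rewrite bigA_distr (bigD1 set0) //= big1 => [|i _]; last by rewrite inE.
  rewrite addrC addrA addNr add0r; apply: eq_bigr => S _.
  by rewrite -big_mkcond prodr_const.
rewrite big_mkcond [leRHS]big_mkcond; apply: ler_sum => S _.
case: ifP => [/andP[S0 nS]|_]; last by case: ifP => // _; apply: exprn_ge0.
have rS : rejecting x S = S.
  apply/setP => u; rewrite inE; case: (boolP (u \in S)) => //= uS.
  by apply/negP => a; case/existsP: nS; exists u; rewrite uS.
by rewrite rS in S0 *; rewrite S0.
Qed.

End Accepted.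

(** * Tensor products of vectors and matrices *)

Section Tensor.
Variables (F : realFieldType) (I : finType) (m : nat).
Let T := {dffun forall v : I, 'I_m}.

(** Matrices are indexed by ordinals, so a product basis state is given by its rank in the
    enumeration of [T]. *)
Definition tensor_coord (i : 'I_#|{: T}|) (v : I) : 'I_m := (enum_val i : T) v.

Definition tensor_vec (f : I -> 'cV[F]_m) : 'cV[F]_#|{: T}| :=
  \col_i \prod_v f v (tensor_coord i v) 0.

Definition tensor_mx (M : I -> 'M[F]_m) : 'M[F]_#|{: T}| :=
  \matrix_(i, j) \prod_v M v (tensor_coord i v) (tensor_coord j v).

Lemma big_dffun_distr (g : I -> 'I_m -> F) :
  \sum_(x : T) \prod_v g v (x v) = \prod_v \sum_j g v j.
Proof.
rewrite bigA_distr_bigA; apply: (reindex (fun x : {ffun I -> 'I_m} => (x : T))).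
by apply: onW_bij; exists (fun x : T => (x : {ffun I -> 'I_m})).
Qed.

Lemma sum_tensor (g : I -> 'I_m -> F) :
  \sum_(i < #|{: T}|) \prod_v g v (tensor_coord i v) = \prod_v \sum_j g v j.
Proof.
rewrite -big_dffun_distr [RHS](reindex (@enum_val _ (mem {: T}))) //.
exact: onW_bij (@enum_val_bij _).
Qed.

Lemma dot_tensor f g :
  dot (tensor_vec f) (tensor_vec g) = \prod_v dot (f v) (g v).
Proof.
under [RHS]eq_bigr => v _ do rewrite dotE.
rewrite -sum_tensor dotE; apply: eq_bigr => i _.
by rewrite !mxE -big_split.
Qed.

Lemma tensor_mx_mul M N :
  tensor_mx M *m tensor_mx N = tensor_mx (fun v => M v *m N v).
Proof.
apply/matrixP => i j; rewrite !mxE.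
under [RHS]eq_bigr => v _ do rewrite mxE.
rewrite -(sum_tensor (fun v l => M v (tensor_coord i v) l * N v l (tensor_coord j v))).
by apply: eq_bigr => l _; rewrite !mxE -big_split.
Qed.

Lemma tensor_mx_vec M f :
  tensor_mx M *m tensor_vec f = tensor_vec (fun v => M v *m f v).
Proof.
apply/colP => i; rewrite !mxE.
under [RHS]eq_bigr => v _ do rewrite mxE.
rewrite -(sum_tensor (fun v l => M v (tensor_coord i v) l * f v l 0)).
by apply: eq_bigr => l _; rewrite !mxE -big_split.
Qed.

Lemma eq_tensor_vec f g : f =1 g -> tensor_vec f = tensor_vec g.
Proof.
by move=> fg; apply/colP => i; rewrite !mxE; apply: eq_bigr => v _; rewrite fg.
Qed.

Lemma tensor_proj M : (forall v, orthoproj (M v)) -> orthoproj (tensor_mx M).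
Proof.
move=> Mp; apply/andP; split; apply/eqP; last first.
  rewrite tensor_mx_mul; apply/matrixP => i j; rewrite !mxE.
  by apply: eq_bigr => v _; case/andP: (Mp v) => _ /eqP->.
apply/matrixP => i j; rewrite !mxE; apply: eq_bigr => v _.
by have /andP[/eqP MT _] := Mp v; rewrite -[in RHS]MT mxE.
Qed.

End Tensor.

(** * Tests for candidate sets and the referee's measurement *)

Section Tests.
Variables (F : realFieldType) (k d n : nat) (f : {ffun 'I_k -> bool} -> 'cV[F]_n).
Variables (a e : F).
Hypothesis f1 : forall x, dot (f x) (f x) = 1.
Hypothesis a0 : 0 <= a.
Hypothesis fa : forall x y, x != y -> `|dot (f x) (f y)| <= a.
Hypothesis small_a : 8 * (k.+1 ^ d)%:R * a <= 1.
Hypothesis ae : 8 * (k.+1 ^ d)%:R * a ^+ 2 <= e ^+ 2.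

(** Take the near-orthonormal projector for the fingerprints of the accepted inputs; a rejected
    input differs from each of them, so its overlaps are at most [a]. *)
Lemma player_test (v : 'I_k) (S : {set 'I_k}) : v \in S ->
  exists P : 'M[F]_n, [/\ orthoproj P,
    forall x, accepted d v S x -> P *m f x = f x &
    forall x, ~~ accepted d v S x -> dot (f x) (P *m f x) <= e ^+ 2].
Proof.
move=> vS; pose s := enum [set x | accepted d v S x].
have ss : (size s)%:R <= (k.+1 ^ d)%:R :> F.
  by rewrite -cardE ler_nat -[X in (X.+1 ^ _)%N]card_ord card_accepted_inputs.
have [|||P [Pp Ps Pb]] := @near_orthonormal_projector F n (map f s) a a0.
- rewrite size_map; apply: le_trans small_a; rewrite ler_wpM2r // ler_wpM2l //.
- by apply/allP => _ /mapP[x _ ->]; rewrite f1.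
- rewrite pairwise_map; apply: (@sub_pairwise _ (fun x y => x != y)) => [x y|].
    exact: fa.
  by rewrite -uniq_pairwise enum_uniq.
exists P; split=> // [x xa|x xa].
  by apply/Ps/map_f; rewrite mem_enum inE.
apply: le_trans ae; apply: le_trans (Pb _ (f1 x) _) _.
  move=> w /mapP[y]; rewrite mem_enum inE => ya ->; apply: fa.
  by apply: contraNneq xa => <-.
by rewrite size_map ler_wpM2r ?sqr_ge0 // ler_wpM2l.
Qed.

Hypothesis e0 : 0 <= e.

Lemma clique_tests : exists P : {set 'I_k} -> 'M[F]_#|{: {dffun forall v : 'I_k, 'I_n}}|,
  (forall S, orthoproj (P S)) /\
  forall (x : 'I_k -> {ffun 'I_k -> bool}) S (u := tensor_vec (fun v => f (x v))),
    (rejecting d x S = set0 -> P S *m u = u) /\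
    dot u (P S *m u) <= (e ^+ #|rejecting d x S|) ^+ 2.
Proof.
have /fin_all_exists[p pP] : forall vS : 'I_k * {set 'I_k}, exists P : 'M[F]_n,
    [/\ orthoproj P,
    forall x, (vS.1 \in vS.2) ==> accepted d vS.1 vS.2 x -> P *m f x = f x &
    forall x, ~~ accepted d vS.1 vS.2 x -> vS.1 \in vS.2 ->
      dot (f x) (P *m f x) <= e ^+ 2].
  move=> [v S] /=; case: (boolP (v \in S)) => vS.
    have [P [Pp Pf Pe]] := player_test vS; exists P; split=> // x xa _; exact: Pe.
  (* A player outside [S] is not tested. *)
  exists 1%:M; split=> // [|x _]; last by rewrite mul1mx.
  by rewrite /orthoproj trmx1 mulmx1 eqxx.
exists (fun S => tensor_mx (fun v => p (v, S))); split=> [S|x S u].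
  by apply: tensor_proj => v; case: (pP (v, S)).
rewrite tensor_mx_vec dot_tensor; split=> [r0|].
  apply: eq_tensor_vec => v; case: (pP (v, S)) => _ /(_ (x v)) + _; apply => /=.
  apply/implyP => vS; have : v \notin rejecting d x S by rewrite r0 inE.
  by rewrite inE vS negbK.
have -> : (e ^+ #|rejecting d x S|) ^+ 2 =
    \prod_v (if v \in rejecting d x S then e ^+ 2 else 1).
  by rewrite -big_mkcond prodr_const exprAC.
apply: ler_prod => v _; case: (pP (v, S)) => pp pa pr.
rewrite -proj_dot // dot_ge0 /= proj_dot //.
case: ifP; rewrite inE; first by case/andP => vS va; apply: pr.
move/negbT; rewrite negb_and negbK -implybE => /pa ->.
by rewrite f1.
Qed.

Lemma clique_measurement : e <= 1 -> 2 * k%:R * e <= 1 ->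
  (k * k.+1 ^ d)%:R * e + 2 * k%:R * e <= 8^-1 ->
  exists A : {set {set 'I_k}} -> 'M[F]_#|{: {dffun forall v : 'I_k, 'I_n}}|,
  \sum_o (A o)^T *m A o = 1%:M /\
  forall x : 'I_k -> {ffun 'I_k -> bool},
    let u := A [set S | rejecting d x S == set0] *m tensor_vec (fun v => f (x v)) in
    (2 / 3 <= dot u u) : Prop.
Proof.
move=> e1 ke sume; have [P [Pp Pu]] := clique_tests.
pose s := enum {set 'I_k}; exists (seq_meas P s); split.
  rewrite -[RHS](seq_meas_complete Pp (enum_uniq {set 'I_k})).
  by apply: eq_bigl => o; symmetry; apply/subsetP => S _; rewrite mem_enum.
move=> x; set u := tensor_vec _; set o := [set S | _] => /=; have u1 : dot u u = 1.
  by rewrite dot_tensor big1 // => v _; rewrite f1.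
have small : \sum_(S <- s | S \notin o) e ^+ #|rejecting d x S| <= 8^-1.
  rewrite big_enum_cond /=; under eq_bigl => S do rewrite inE.
  apply: le_trans (sum_rejecting d x e0 e1) _; apply: le_trans sume.
  by rewrite card_ord lerD2l expr1D_sub1_le.
have amp : 1 - \sum_(S <- s | S \notin o) e ^+ #|rejecting d x S| <=
    dot u (seq_meas P s o *m u).
  apply: seq_meas_amplitude => // [S|S|S _].
  - by rewrite exprn_ge0.
  - by rewrite inE => /eqP r0; have [->] := Pu x S.
  - by have [_] := Pu x S.
(* Cauchy-Schwarz against the unit vector [u] turns amplitude at least [7/8] into probability at
   least [49/64], which exceeds [2/3]. *)
have := dot_sqr_le u (seq_meas P s o *m u).
rewrite u1 mul1r; apply: le_trans.
set t := dot _ _ in amp *; have t78 : 7 / 8 <= t by move: small amp; lra.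
by rewrite expr2; nra.
Qed.

End Tests.

(** * Choice of parameters *)

Lemma protocol_parameters (F : realFieldType) (k d : nat) (L := up_log 2 k)
    (z : F := (2 ^+ (L * d))^-1) :
  (2 <= k)%N -> (1 <= d)%N ->
  [/\ 0 < z, k%:R / 4 ^+ (6 * (L * d)) <= z ^+ 11,
    8 * (k.+1 ^ d)%:R * z ^+ 11 <= 1,
    8 * (k.+1 ^ d)%:R * (z ^+ 11) ^+ 2 <= (z ^+ 8) ^+ 2 &
    [/\ z ^+ 8 <= 1, 2 * k%:R * z ^+ 8 <= 1 &
    (k * k.+1 ^ d)%:R * z ^+ 8 + 2 * k%:R * z ^+ 8 <= 8^-1]].
Proof.
move=> k2 d1; have L0 : (0 < L)%N by rewrite up_log_gt0.
(* With [z = 1 / q], each bound splits into factors at most 1: [2 z], [k z], [(k + 1) ^ d z ^ 2] and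
   spare powers of [z]. The third uses [k + 1 <= 4 ^ L]. *)
pose q := (2 ^ (L * d))%N.
have kL : (k <= 2 ^ L)%N by apply: up_logP.
have kq : (k <= q)%N.
  by apply: leq_trans kL _; rewrite leq_exp2l // leq_pmulr.
have k1q : (k.+1 ^ d <= q ^ 2)%N.
  rewrite -expnM mulnAC expnM leq_exp2r //; apply: leq_ltn_trans kL _.
  by rewrite ltn_exp2l // -[X in (X < _)%N]muln1 ltn_pmul2l.
have q2 : (2 <= q)%N by rewrite -[X in (X <= _)%N]expn1 leq_exp2l // muln_gt0 L0.
have zE : z = q%:R^-1 by rewrite /z natrX.
have z0 : 0 < z by rewrite zE invr_gt0 ltr0n (leq_trans _ q2).
have qz : q%:R * z = 1 by rewrite zE divff // pnatr_eq0 -lt0n (leq_trans _ q2).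
have z2 : 2 * z <= 1 by rewrite -[leRHS]qz ler_pM2r // ler_nat.
have kz : k%:R * z <= 1 by rewrite -[leRHS]qz ler_pM2r // ler_nat.
have kdz : (k.+1 ^ d)%:R * z ^+ 2 <= 1.
  have qz2 : (q ^ 2)%:R * z ^+ 2 = 1 :> F by rewrite natrX -exprMn qz expr1n.
  by rewrite -[leRHS]qz2 ler_pM2r ?exprn_gt0 // ler_nat.
have z3 : 8 * z ^+ 3 <= 1.
  have -> : 8 * z ^+ 3 = (2 * z) ^+ 3 by ring.
  by rewrite exprn_ile1 // mulr_ge0 // ltW.
have zge0 := ltW z0.
have z1 : z <= 1 by move: z2 z0; lra.
have zn m : 0 <= z ^+ m by rewrite exprn_ge0 // ltW.
have zn1 m : z ^+ m <= 1 by rewrite exprn_ile1 // ltW.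
have k0 : 0 <= k%:R :> F by [].
have kd0 : 0 <= (k.+1 ^ d)%:R :> F by [].
have z3_ge0 : 0 <= 8 * z ^+ 3 by rewrite mulr_ge0.
have z2_ge0 : 0 <= 2 * z by rewrite mulr_ge0.
have kz_ge0 : 0 <= k%:R * z by rewrite mulr_ge0.
have kdz_ge0 : 0 <= (k.+1 ^ d)%:R * z ^+ 2 by rewrite mulr_ge0.
split=> //.
(* Of the twelve factors [1 / q], one absorbs [k] and eleven remain. *)
- have -> : (4 : F) ^+ (6 * (L * d)) = (q%:R) ^+ 12.
    rewrite /q natrX -!exprM; have -> : (4 : F) = 2 ^+ 2 by rewrite expr2 -natrM.
    by rewrite -exprM; congr (_ ^+ _); rewrite mulnA (mulnC (L * d)%N).
  rewrite -exprVn -zE exprS mulrA -[leRHS]mul1r ler_wpM2r //.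
- rewrite (_ : _ * z ^+ 11 = (8 * z ^+ 3) * ((k.+1 ^ d)%:R * z ^+ 2) * z ^+ 6);
    last by ring.
  by apply: mulr_ile1 => //; [apply: mulr_ge0|apply: mulr_ile1].
- rewrite (_ : _ * _ =
      (8 * z ^+ 3) * ((k.+1 ^ d)%:R * z ^+ 2) * z * (z ^+ 8) ^+ 2); last by ring.
  rewrite -[leRHS]mul1r ler_wpM2r ?exprn_ge0 //.
  by apply: mulr_ile1 => //; [apply: mulr_ge0|apply: mulr_ile1].
split=> //.
- rewrite (_ : _ * z ^+ 8 = (2 * z) * (k%:R * z) * z ^+ 6); last by ring.
  by apply: mulr_ile1 => //; [apply: mulr_ge0|apply: mulr_ile1].
have -> : (k * k.+1 ^ d)%:R * z ^+ 8 + 2 * k%:R * z ^+ 8 =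
   ((k%:R * z) * ((k.+1 ^ d)%:R * z ^+ 2) + (k%:R * z) * (2 * z) * z) * z ^+ 5.
  by rewrite natrM; ring.
have s1 : (k%:R * z) * ((k.+1 ^ d)%:R * z ^+ 2) <= 1 by apply: mulr_ile1.
have s2 : (k%:R * z) * (2 * z) * z <= 1.
  by apply: mulr_ile1 => //; [apply: mulr_ge0|apply: mulr_ile1].
have z5 : z ^+ 5 <= 16^-1.
  have -> : z ^+ 5 = (2 * z) ^+ 4 * z * 16^-1 by field.
  rewrite -[leRHS]mul1r ler_wpM2r ?invr_ge0 //.
  by apply: mulr_ile1; rewrite ?exprn_ge0 ?exprn_ile1.
apply: (@le_trans _ _ (2 * 16^-1)); last by lra.
apply: ler_pM => //; last by move: s1 s2; lra.
by rewrite addr_ge0 // !mulr_ge0 // ltW.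
Qed.

(** * From real vectors to a complex quantum protocol *)

Local Notation R := Rdefinitions.R.
Local Notation toC := (real_complex R : R -> Defs.C).

Lemma conj_toC (x : R) : (toC x)^* = toC x.
Proof. exact: conjc_real. Qed.

(** Irreflexivity supplies the no-loop clause of [accepted]; the other two clauses, over all members
    of [S], are the clique and isolation conditions. *)
Lemma rejecting_eq0 k d (g : rel 'I_k) S : simple_graph g ->
  (rejecting d (nbhd_vec g) S == set0) = max_d_isolated_clique d g S.
Proof.
case=> _ girr; rewrite /max_d_isolated_clique.
have acc u : u \in S -> accepted d u S (nbhd_vec g u) =
    [forall w in S, (u != w) ==> g u w] && (#|[set w in ~: S | g u w]| <= d)%N.
  move=> uS; rewrite /accepted ffunE girr /=; congr andb.
    by apply: eq_forallb_in => w _; rewrite ffunE eq_sym.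
  by congr (_ <= _)%N; apply: eq_card => w; rewrite !inE ffunE.
apply/eqP/andP => [/setP r0|[/forall_inP cl /forall_inP iso]].
  have ra u : u \in S -> accepted d u S (nbhd_vec g u).
    by move=> uS; have := r0 u; rewrite !inE uS /= => /negbFE.
  by split; apply/forall_inP => u uS; have := ra u uS; rewrite acc // => /andP[].
apply/setP => u; rewrite !inE; apply/negP => /andP[uS].
by rewrite acc // cl // iso.
Qed.

Section Embedding.
Variables (k n : nat) (O : finType) (f : {ffun 'I_k -> bool} -> 'cV[R]_(2 ^ n)).
Local Notation T := {dffun forall v : 'I_k, 'I_(2 ^ n)}.
Variable A : O -> 'M[R]_#|{: T}|.
Hypothesis f1 : forall x, dot (f x) (f x) = 1.
Hypothesis A1 : \sum_o (A o)^T *m A o = 1%:M.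

(** The messages are the pure states [f x (f x)^T], and the effect of outcome [o] is
    [(A o)^T A o]. *)
Definition real_protocol : qnih_protocol k O :=
  @QNIH k O (fun _ => n) (fun _ x i j => toC (f x i 0 * f x j 0))
    (fun o (x y : T) => toC (((A o)^T *m A o) (enum_rank x) (enum_rank y))).

Lemma real_protocol_valid : valid_protocol real_protocol.
Proof.
split=> [v x|]; split.
(* The rank-one projector onto a unit vector is its own square root. *)
- exists (fun i j => toC (f x i 0 * f x j 0)) => i j.
  rewrite /= -[f x i 0 * _]mulr1 -(f1 x) dotE mulr_sumr rmorph_sum.
  apply: eq_bigr => l _; rewrite conj_toC -rmorphM; congr toC; ring.
- by rewrite /trace /= -rmorph_sum -dotE f1 rmorph1.
- move=> o; exists (fun (x z : T) => toC (A o (enum_rank z) (enum_rank x))) => x y.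
  rewrite /= mxE rmorph_sum [RHS](reindex (@enum_val _ (mem {: T}))) /=; last first.
    exact: onW_bij (@enum_val_bij _).
  by apply: eq_bigr => l _; rewrite conj_toC -rmorphM mxE enum_valK.
- move=> x y; rewrite /= -rmorph_sum -summxE A1 mxE (inj_eq enum_rank_inj).
  by rewrite rmorph_nat.
Qed.

(** The joint state is the pure state [u u^T], and the trace of [A^T A u u^T] is the squared norm of
    [A u]. *)
Lemma real_protocol_prob g o (u := tensor_vec (fun v => f (nbhd_vec g v))) :
  out_prob real_protocol g o = toC (dot (A o *m u) (A o *m u)).
Proof.
have jointE (x y : T) :
    joint_state real_protocol g x y = toC (u (enum_rank x) 0 * u (enum_rank y) 0).
  by rewrite /joint_state /= -rmorph_prod !mxE /tensor_coord !enum_rankK -big_split.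
rewrite /out_prob /trace dot_mulmxl mulmxA dotE rmorph_sum.
rewrite (reindex (@enum_val _ (mem {: T}))) /=; last exact: onW_bij (@enum_val_bij _).
apply: eq_bigr => i _.
rewrite (reindex (@enum_val _ (mem {: T}))) /=; last exact: onW_bij (@enum_val_bij _).
rewrite [X in _ * X]mxE mulr_sumr rmorph_sum; apply: eq_bigr => j _.
rewrite jointE !enum_valK -rmorphM; congr toC; ring.
Qed.

End Embedding.

Theorem theorem19 :
  exists c : nat, forall d : nat, (1 <= d)%N -> forall k : nat, (2 <= k)%N ->
    exists P : qnih_protocol k {set {set 'I_k}},
      valid_protocol P /\
      (cost P <= c * k * d * (up_log 2 k) ^ 2)%N /\
      forall g : rel 'I_k, simple_graph g ->
        2 / 3 <= out_prob P g (all_max_d_isolated_cliques d g).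
Proof.
(* [24 = 4 * 6]: a fingerprint takes [4 * h] qubits and [h = 6 * (L * d)]. *)
exists 24%N => d d1 k k2; pose L := up_log 2 k.
have L0 : (0 < L)%N by rewrite up_log_gt0.
have [z0 overlap small_a ae [e1 ke sume]] := @protocol_parameters R k d k2 d1.
set z := (_^-1) in z0 overlap small_a ae e1 ke sume.
have [|f [f1 fo]] := @fingerprints R k (6 * (L * d)).
  by rewrite !muln_gt0 L0.
have fa x y : x != y -> `|dot (f x) (f y)| <= z ^+ 11.
  by move=> xy; apply: le_trans (fo x y xy) overlap.
have [||A [A1 Asucc]] := @clique_measurement R k d _ f (z ^+ 11) (z ^+ 8)
  f1 _ fa small_a ae _ e1 ke sume.
- by rewrite exprn_ge0 // ltW.
- by rewrite exprn_ge0 // ltW.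
exists (real_protocol f A); split; first exact: real_protocol_valid.
split.
  rewrite /cost /= sum_nat_const card_ord.
  (* The cost is linear in [L], and [L ^ 1 <= L ^ 2] as [L] is positive. *)
  have -> : (k * (4 * (6 * (L * d))) = 24 * k * d * L ^ 1)%N by rewrite expn1; ring.
  by rewrite leq_mul2l leq_pexp2l ?orbT.
move=> g sg; rewrite real_protocol_prob.
have -> : all_max_d_isolated_cliques d g = [set S | rejecting d (nbhd_vec g) S == set0].
  by apply/setP => S; rewrite !inE rejecting_eq0.
have -> : 2 / 3 = toC (2 / 3) by rewrite fmorph_div !rmorph_nat.
rewrite lecR; exact: Asucc.
Qed.
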